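(* Let $\gamma$ be a $3$-Frenet helix, with constant curvatures $\kappa,\tau$, parametrized by the arc length $s$ in an $m$-dimensional semi-Riemannian space form $N^m_t(c)$, $m\ge3$, $1\le t\le m-1$. Then: (i) $\gamma$ is a proper biharmonic ($2$-harmonic) curve if and only if $\epsilon_2(\epsilon_1\kappa^2+\epsilon_3\tau^2)=c\,\epsilon_1$; (ii) $\gamma$ is a proper triharmonic ($3$-harmonic) curve if and only if $\epsilon_2(\epsilon_1\kappa^2+\epsilon_3\tau^2)^2=c\,(\epsilon_1\epsilon_3\tau^2+2\kappa^2)$; (iii) for $r\ge4$, $\gamma$ is a proper $r$-harmonic curve if and only if $$(\epsilon_1\kappa^2+\epsilon_3\tau^2)^{r-3}\Big[\epsilon_2(\epsilon_1\kappa^2+\epsilon_3\tau^2)^2-c\big(\epsilon_1\epsilon_3\tau^2+(r-1)\kappa^2\big)\Big]=0.$$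
   Context: Conventions. For a semi-Riemannian manifold $(M,\langle\,,\rangle)$ with Levi-Civita connection $\nabla$, $R(X,Y)Z=\nabla_X\nabla_YZ-\nabla_Y\nabla_XZ-\nabla_{[X,Y]}Z$. Curves $\gamma:I\to M$ ($I$ an open real interval) are smooth, nonnull, parametrized by arc length; $T=\gamma'$. Put $\nabla_T^0T=T$, $\nabla_T^jT=\nabla_T(\nabla_T^{j-1}T)$. For $r\ge2$, $\gamma$ is $r$-harmonic if $$\tau_r(\gamma)=\nabla^{2r-1}_T T+\sum_{\ell=0}^{r-2}(-1)^\ell R\big(\nabla^{2r-3-\ell}_T T,\nabla^{\ell}_T T\big)T=0,$$ and proper $r$-harmonic if it is $r$-harmonic and not a geodesic. A $3$-Frenet curve is a curve admitting a frame $\{F_1=T,F_2=N,F_3=B\}$ along it with $\langle F_i,F_i\rangle=\epsilon_i=\pm1$, $\langle F_i,F_j\rangle=0$ for $i\ne j$, and $\nabla_TT=\epsilon_2kN$, $\nabla_TN=-\epsilon_1kT+\epsilon_3\tau B$, $\nabla_TB=-\epsilon_2\tau N$, where $k(s)$ and $\tau(s)$ are positive functions (if $m=3$ and the manifold is oriented, $\tau$ is allowed to take any real value, $B$ being fixed by requiring the frame to be positively oriented). It is a helix if the curvatures are constant, denoted $\kappa,\tau$. Space forms: let $\mathbb{R}^n_t$ be $\mathbb{R}^n$ with $\langle x,y\rangle=-\sum_{i=1}^t x_iy_i+\sum_{i=t+1}^n x_iy_i$. $N^m_t(c)$ denotes $\mathbb{R}^m_t$ if $c=0$, $\{x\in\mathbb{R}^{m+1}_t:\langle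 x,x\rangle=1/c\}$ if $c>0$, $\{x\in\mathbb{R}^{m+1}_{t+1}:\langle x,x\rangle=1/c\}$ if $c<0$, with the induced metric of index $t$; its curvature is $R(X,Y)Z=c(\langle Y,Z\rangle X-\langle X,Z\rangle Y)$. *)

(* Defs.v *)
From HB Require Import structures.
From mathcomp Require Import all_boot all_order all_algebra.
From mathcomp Require Import all_classical all_reals all_analysis.

Set Implicit Arguments.
Unset Strict Implicit.
Unset Printing Implicit Defensive.

Import Order.TTheory GRing.Theory Num.Theory.
Import numFieldNormedType.Exports.
Local Open Scope classical_set_scope.
Local Open Scope ring_scope.

Definition pdot (R : realType) (n p : nat) (x y : 'rV[R]_n) : R :=
  - (\sum_(i < n | (i < p)%N) x 0 i * y 0 i)
  + \sum_(i < n | (p <= i)%N) x 0 i * y 0 i.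

(* [R^n_p] with [n = ambient_dim c m] and [p = ambient_index c t] is the
   pseudo-Euclidean space in which [N^m_t(c)] is embedded. *)
Definition ambient_dim (R : realType) (c : R) (m : nat) : nat :=
  if c == 0 then m else m.+1.

Definition ambient_index (R : realType) (c : R) (t : nat) : nat :=
  if c < 0 then t.+1 else t.

Section SpaceForm.
Variables (R : realType) (c : R) (m t : nat).

Notation E := 'rV[R]_(ambient_dim c m).
Notation "<< x , y >>" := (pdot (ambient_index c t) x y).

Definition space_form : set E := [set x | c != 0 -> << x, x >> = c^-1].

Definition tangent_space (x : E) : set E := [set v | c != 0 -> << v, x >> = 0].

(* The orthogonal projection of [R^n_p] onto [tangent_space x], for [x] in
   [space_form]: if [c != 0], the normal line is spanned by [x] and
   [<< x, x >> = 1/c]; if [c = 0], this is the identity. *)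
Definition tangent_proj (x v : E) : E := v - (c * << v, x >>) *: x.

(* The curvature tensor of [N^m_t(c)], for the sign convention
   [R(X,Y)Z = D_X D_Y Z - D_Y D_X Z - D_[X,Y] Z]. *)
Definition curvature (X Y Z : E) : E := c *: (<< Y, Z >> *: X - << X, Z >> *: Y).

(* Curves and vector fields along them are total functions on [R]; only their
   values on the open interval [I] are constrained or used. *)
Definition smooth_on (I : set R) (V : R -> E) : Prop :=
  forall n s, I s -> derivable (derive1n n V) s 1.

Definition velocity (gam : R -> E) : R -> E := derive1 gam.

(* Covariant derivative along [gam] of a vector field [V] tangent to
   [N^m_t(c)]: the Levi-Civita connection of the induced metric is the
   tangential part of the flat connection of the ambient space. *)
Definition covD (gam V : R -> E) : R -> E :=
  fun s => tangent_proj (gam s) (derive1 V s).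

Definition covDn (gam : R -> E) (j : nat) : R -> E :=
  iter j (covD gam) (velocity gam).

Definition unit_speed_curve (I : set R) (gam : R -> E) : Prop :=
  [/\ smooth_on I gam,
      forall s, I s -> space_form (gam s) &
      forall s, I s -> `| << velocity gam s, velocity gam s >> | = 1].

Definition tangent_field (I : set R) (gam V : R -> E) : Prop :=
  smooth_on I V /\ forall s, I s -> tangent_space (gam s) (V s).

Definition tension (r : nat) (gam : R -> E) (s : R) : E :=
  covDn gam (2 * r - 1) s
  + \sum_(l < r.-1) (-1) ^+ l *:
      curvature (covDn gam (2 * r - 3 - l) s) (covDn gam l s) (velocity gam s).

Definition harmonic (r : nat) (I : set R) (gam : R -> E) : Prop :=
  forall s, I s -> tension r gam s = 0.

Definition geodesic (I : set R) (gam : R -> E) : Prop :=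
  forall s, I s -> covD gam (velocity gam) s = 0.

Definition proper_harmonic (r : nat) (I : set R) (gam : R -> E) : Prop :=
  harmonic r I gam /\ ~ geodesic I gam.

(* Orientation of a frame [v1, v2, v3] at [x], used for [m = 3] only.  The
   connected manifold [N^3_t(c)] has two orientations, indexed by [o]: that of
   [R^3] up to sign if [c = 0], and otherwise that of [R^4] contracted with
   the normal vector [x], up to sign. *)
Definition positively_oriented (o : bool) (x v1 v2 v3 : E) : Prop :=
  let vs := if c == 0 then [:: v1; v2; v3] else [:: x; v1; v2; v3] in
  0 < (-1) ^+ o * \det (\matrix_(i, j) (nth 0 vs i) 0 j : 'M[R]_(ambient_dim c m)).

Definition frenet_curve (o : bool) (I : set R) (gam : R -> E)
    (e1 e2 e3 : R) (k tau : R -> R) : Prop :=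
  unit_speed_curve I gam /\
  exists N B : R -> E, let T := velocity gam in
    [/\ tangent_field I gam N /\ tangent_field I gam B,
        [/\ e1 = 1 \/ e1 = -1, e2 = 1 \/ e2 = -1 & e3 = 1 \/ e3 = -1],
        forall s, I s ->
          [/\ << T s, T s >> = e1, << N s, N s >> = e2 & << B s, B s >> = e3] /\
          [/\ << T s, N s >> = 0, << T s, B s >> = 0 & << N s, B s >> = 0],
        forall s, I s ->
          [/\ covD gam T s = (e2 * k s) *: N s,
              covD gam N s = - (e1 * k s) *: T s + (e3 * tau s) *: B s &
              covD gam B s = - (e2 * tau s) *: N s] &
        (forall s, I s -> 0 < k s) /\
        ((forall s, I s -> 0 < tau s) \/
         m = 3%N /\
         forall s, I s -> positively_oriented o (gam s) (T s) (N s) (B s))].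

Definition frenet_helix (o : bool) (I : set R) (gam : R -> E)
    (e1 e2 e3 kappa tau : R) : Prop :=
  frenet_curve o I gam e1 e2 e3 (fun=> kappa) (fun=> tau).

End SpaceForm.

(* Main.v *)
(** Put [a = e2 (e1 kappa^2 + e3 tau^2)].  The Frenet equations give
    [D^3 T = - a D T], so that the iterated derivatives of [T] are
    [D^(2j+1) T = (-a)^j D T] and [D^(2j+2) T = (-a)^j D^2 T].  In the tension
    field the two arguments of each curvature term have orders of opposite
    parity, only the even one has a component along [T], and each of the terms
    with [l >= 1] contributes the same multiple of [N].  Hence
    [tau_(q+2) = e2 kappa ((-a)^(q+1) + c e1 (-a)^q - q c e2 kappa^2 (-a)^(q-1)) N],
    which vanishes exactly when its scalar factor does. *)
Require Import Defs.
From HB Require Import structures.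
From mathcomp Require Import all_boot all_order all_algebra.
From mathcomp Require Import all_classical all_reals all_analysis.
From mathcomp Require Import zify ring.

Set Implicit Arguments.
Unset Strict Implicit.
Unset Printing Implicit Defensive.

Import Order.TTheory GRing.Theory Num.Theory.
Import numFieldNormedType.Exports.
Local Open Scope classical_set_scope.
Local Open Scope ring_scope.

Lemma pdotDl (R : realType) (n p : nat) (x y z : 'rV[R]_n) :
  pdot p (x + y) z = pdot p x z + pdot p y z.
Proof.
rewrite /pdot addrACA -opprD -!big_split /=.
by congr (- _ + _); apply: eq_bigr => i _; rewrite mxE mulrDl.
Qed.

Lemma pdotZl (R : realType) (n p : nat) (a : R) (x y : 'rV[R]_n) :
  pdot p (a *: x) y = a * pdot p x y.
Proof.
rewrite /pdot mulrDr mulrN !mulr_sumr.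
by congr (- _ + _); apply: eq_bigr => i _; rewrite mxE mulrA.
Qed.

Lemma pdotC (R : realType) (n p : nat) (x y : 'rV[R]_n) :
  pdot p x y = pdot p y x.
Proof.
by rewrite /pdot; congr (- _ + _); apply: eq_bigr => i _; rewrite mulrC.
Qed.

Lemma smooth_on_derivable (R : realType) (c : R) (m : nat) (I : set R)
    (V : R -> 'rV[R]_(ambient_dim c m)) (s : R) :
  smooth_on I V -> I s -> derivable V s 1.
Proof. by move=> sV Is; apply: (sV 0%N). Qed.

(** The derivative at [s] depends only on the germ of the field, and [I] is a neighbourhood of [s].
    This allows a formula known only on [I] to be differentiated again. *)
Lemma eq_on_covD (R : realType) (c : R) (m t : nat) (I : set R)
    (gam V W : R -> 'rV[R]_(ambient_dim c m)) (s : R) :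
  open I -> (forall u, I u -> V u = W u) -> I s ->
  covD t gam V s = covD t gam W s.
Proof.
move=> Iop VW Is; rewrite /covD !derive1E; congr tangent_proj.
apply: near_eq_derive; near=> u; apply: VW; near: u.
by move: Iop; rewrite openE; apply.
Unshelve. all: by end_near.
Qed.

Lemma tangent_proj_linear (R : realType) (c : R) (m t : nat)
    (x v w : 'rV[R]_(ambient_dim c m)) (a b : R) :
  tangent_proj t x (a *: v + b *: w) =
    a *: tangent_proj t x v + b *: tangent_proj t x w.
Proof.
rewrite /tangent_proj pdotDl !pdotZl !scalerBr !scalerA addrACA -opprD -scalerDl.
by congr (_ - _ *: _); ring.
Qed.

(** The coefficients are constants, as they are along a helix, so no Leibniz term appears. *)
Lemma covD_linear (R : realType) (c : R) (m t : nat)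
    (gam V W : R -> 'rV[R]_(ambient_dim c m)) (a b s : R) :
  derivable V s 1 -> derivable W s 1 ->
  covD t gam (fun u => a *: V u + b *: W u) s =
    a *: covD t gam V s + b *: covD t gam W s.
Proof.
move=> dV dW; rewrite /covD -tangent_proj_linear !derive1E; congr tangent_proj.
have daV : derivable (a \*: V) s 1 by exact: derivableZ.
have dbW : derivable (b \*: W) s 1 by exact: derivableZ.
have := deriveD daV dbW.
by rewrite (deriveZ a dV) (deriveZ b dW); exact.
Qed.

Lemma covD_scale (R : realType) (c : R) (m t : nat)
    (gam V : R -> 'rV[R]_(ambient_dim c m)) (a s : R) :
  derivable V s 1 -> covD t gam (fun u => a *: V u) s = a *: covD t gam V s.
Proof.
move=> dV; rewrite /covD !derive1E (deriveZ a dV).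
set v := derive _ _ _; clearbody v.
by rewrite /tangent_proj pdotZl scalerBr scalerA mulrCA.
Qed.

Lemma sign_sqr (R : realType) (e : R) : e = 1 \/ e = -1 -> e * e = 1.
Proof. by case=> ->; rewrite ?mulrNN mulr1. Qed.

(* For [q = 0] the junk exponent [q.-1 = 0] is cancelled by the factor [q]. *)
Lemma alternating_tension (R : realType) (c : R) (m t : nat)
    (D : nat -> 'rV[R]_(ambient_dim c m)) (N W : 'rV[R]_(ambient_dim c m))
    (a b e1 w : R) (q : nat) :
  let T := D 0%N in
  pdot (ambient_index c t) T T = e1 -> pdot (ambient_index c t) N T = 0 ->
  pdot (ambient_index c t) W T = w ->
  (forall j, D j.*2.+1 = (a ^+ j * b) *: N) ->
  (forall j, D j.*2.+2 = (a ^+ j * b) *: W) ->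
  D (2 * q.+2 - 1)%N
    + \sum_(l < q.+1) (-1) ^+ l *: curvature t (D (2 * q.+2 - 3 - l)%N) (D l) T =
  (b * (a ^+ q.+1 + c * e1 * a ^+ q + q%:R * (c * b * w * a ^+ q.-1))) *: N.
Proof.
move=> T TT NT WT odd even.
have oddT j : pdot (ambient_index c t) (D j.*2.+1) T = 0.
  by rewrite odd pdotZl NT mulr0.
have evenT j : pdot (ambient_index c t) (D j.*2.+2) T = a ^+ j * b * w.
  by rewrite even pdotZl WT.
(* The term [l = 0] is split off: [D 0 = T] is not covered by [even], and it produces the
   coefficient [c * e1]. *)
rewrite big_ord_recl expr0 scale1r; change (nat_of_ord ord0) with 0%N.
have -> : (2 * q.+2 - 1 = q.+1.*2.+1)%N by lia.
have -> : (2 * q.+2 - 3 - 0 = q.*2.+1)%N by lia.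
rewrite {1}/curvature oddT scale0r subr0 TT !odd.
rewrite (eq_bigr (fun _ => (c * b * w * a ^+ q.-1 * b) *: N)).
  rewrite sumr_const card_ord -scaler_nat !scalerA -!scalerDl; congr (_ *: _).
  by ring.
move=> i _; rewrite lift0 /curvature.
have iq := ltn_ord i.
(* Here [l = i.+1]. For odd [i] the second argument [D l] has even order and the sign is [+]. For
   even [i] the first argument has even order, and the minus sign of the curvature cancels
   [(-1) ^+ l]. *)
case: (boolP (ssrnat.odd i)) => oi.
- have [j ij] : exists j, (i : nat) = j.*2.+1.
    by exists i./2; rewrite -[LHS]odd_double_half oi.
  have -> : (2 * q.+2 - 3 - i.+1 = (q.-1 - j).*2.+1)%N by lia.
  rewrite ij oddT scale0r subr0 evenT odd !scalerA; congr (_ *: _).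
  (* The powers of [a] from the two arguments add up to [q.-1], whatever [j] is; [i < q] keeps the
     subtraction from truncating. *)
  have -> : q.-1 = (j + (q.-1 - j))%N by lia.
  by rewrite addKn exprD -signr_odd /= odd_double expr0; ring.
- have [j ij] : exists j, (i : nat) = j.*2.
    by exists i./2; rewrite -[LHS]odd_double_half (negbTE oi).
  have -> : (2 * q.+2 - 3 - i.+1 = (q.-1 - j).*2.+2)%N by lia.
  rewrite ij oddT scale0r sub0r evenT odd -scaleNr !scalerA; congr (_ *: _).
  have -> : q.-1 = (j + (q.-1 - j))%N by lia.
  by rewrite addKn exprD -signr_odd /= odd_double expr1; ring.
Qed.

Lemma frenet_helix_covDn (R : realType) (c : R) (m t : nat) (I : set R)
    (gam N B : R -> 'rV[R]_(ambient_dim c m)) (e1 e2 e3 kappa tau : R) :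
  open I -> e2 * e2 = 1 ->
  (forall s, I s -> derivable (velocity gam) s 1) ->
  (forall s, I s -> derivable N s 1) -> (forall s, I s -> derivable B s 1) ->
  (forall s, I s ->
     [/\ covD t gam (velocity gam) s = (e2 * kappa) *: N s,
         covD t gam N s =
           - (e1 * kappa) *: velocity gam s + (e3 * tau) *: B s &
         covD t gam B s = - (e2 * tau) *: N s]) ->
  let a := e2 * (e1 * kappa ^+ 2 + e3 * tau ^+ 2) in
  forall j s, I s ->
    covDn t gam j.*2.+1 s = ((- a) ^+ j * (e2 * kappa)) *: N s /\
    covDn t gam j.*2.+2 s = ((- a) ^+ j * (e2 * kappa)) *:
      (- (e1 * kappa) *: velocity gam s + (e3 * tau) *: B s).
Proof.
move=> Iop e22 dT dN dB FE a.
(* One differentiation passes from order [2j+1] to [2j+2], so the induction runs over odd orders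
   only. *)
have even j : (forall s, I s ->
    covDn t gam j.*2.+1 s = ((- a) ^+ j * (e2 * kappa)) *: N s) ->
  forall s, I s -> covDn t gam j.*2.+2 s = ((- a) ^+ j * (e2 * kappa)) *:
      (- (e1 * kappa) *: velocity gam s + (e3 * tau) *: B s).
  move=> IH s Is; rewrite /covDn iterS (eq_on_covD t gam Iop IH Is).
  by rewrite covD_scale; [have [_ -> _] := FE s Is | exact: dN].
suff odd : forall j s, I s ->
    covDn t gam j.*2.+1 s = ((- a) ^+ j * (e2 * kappa)) *: N s.
  by move=> j s Is; split; [exact: odd | exact: even (odd j) _ Is].
elim=> [|j IH] s Is.
  by have [DT _ _] := FE s Is; rewrite expr0 mul1r -DT.
have eqV u : I u -> covDn t gam j.*2.+2 u =
    ((- a) ^+ j * (e2 * kappa) * - (e1 * kappa)) *: velocity gam u +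
    ((- a) ^+ j * (e2 * kappa) * (e3 * tau)) *: B u.
  by move=> Iu; rewrite even// scalerDr !scalerA.
rewrite doubleS /covDn iterS (eq_on_covD t gam Iop eqV Is).
rewrite covD_linear; [|exact: dT|exact: dB].
have [-> _ ->] := FE s Is; rewrite !scalerA -scalerDl; congr (_ *: _).
(* The new factor is [- (e1 * kappa) * (e2 * kappa) - (e3 * tau) * (e2 * tau) = - a]. *)
by rewrite exprS /a; ring.
Qed.

Lemma frenet_helix_tension (R : realType) (c : R) (m t : nat) (o : bool)
    (I : set R) (gam : R -> 'rV[R]_(ambient_dim c m)) (e1 e2 e3 kappa tau : R) :
  open I -> frenet_helix t o I gam e1 e2 e3 kappa tau ->
  let a := e2 * (e1 * kappa ^+ 2 + e3 * tau ^+ 2) in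
  exists N : R -> 'rV[R]_(ambient_dim c m),
    [/\ forall s, I s -> N s != 0,
        forall s, I s ->
          covD t gam (velocity gam) s = (e2 * kappa) *: N s &
        forall q s, I s -> tension t q.+2 gam s =
          (e2 * kappa * ((- a) ^+ q.+1 + c * e1 * (- a) ^+ q
             - q%:R * (c * e2 * kappa ^+ 2 * (- a) ^+ q.-1))) *: N s].
Proof.
move=> Iop [[sgam _ _] [N [B [[[sN _] [sB _]] [he1 he2 _] orth FE _]]]] a.
have e11 := sign_sqr he1; have e22 := sign_sqr he2.
have dT s : I s -> derivable (velocity gam) s 1 by move=> Is; apply: (sgam 1%N).
have dN s (Is : I s) := smooth_on_derivable sN Is.
have dB s (Is : I s) := smooth_on_derivable sB Is.
have covDnE := frenet_helix_covDn Iop e22 dT dN dB FE.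
exists N; split=> [s Is|s Is|q s Is].
(* A zero [N s] would give [e2 = 0], against [e2 * e2 = 1]. *)
- apply/eqP => N0; have [[_ + _] _] := orth s Is.
  rewrite N0 -(scale0r (0 : 'rV[R]_(ambient_dim c m))) pdotZl mul0r => e20.
  by move: e22; rewrite -e20 mul0r => /eqP; rewrite eq_sym oner_eq0.
- by have [] := FE s Is.
have [[TT NN BB] [TN TB NB]] := orth s Is.
set b := e2 * kappa.
have odd j : covDn t gam j.*2.+1 s = ((- a) ^+ j * b) *: N s.
  by have [] := covDnE j s Is.
have even j : covDn t gam j.*2.+2 s = ((- a) ^+ j * b) *:
    (- (e1 * kappa) *: velocity gam s + (e3 * tau) *: B s).
  by have [] := covDnE j s Is.
have WT : pdot (ambient_index c t)
    (- (e1 * kappa) *: velocity gam s + (e3 * tau) *: B s) (velocity gam s) =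
    - kappa.
  by rewrite pdotDl !pdotZl TT (pdotC _ (B s)) TB; ring: e11.
have NT : pdot (ambient_index c t) (N s) (velocity gam s) = 0.
  by rewrite pdotC.
transitivity ((b * ((- a) ^+ q.+1 + c * e1 * (- a) ^+ q +
    q%:R * (c * b * - kappa * (- a) ^+ q.-1))) *: N s).
  exact: (alternating_tension (D := fun j => covDn t gam j s) q TT NT WT odd even).
by congr (_ *: _); rewrite /b; ring.
Qed.

Theorem theorem1p12 (R : realType) (c : R) (m t : nat)
    (hm : (3 <= m)%N) (ht : (1 <= t <= m - 1)%N)
    (o : bool) (I : set R)
    (I_open : open I) (I_itv : is_interval I) (I_neq0 : I !=set0)
    (gam : R -> 'rV[R]_(ambient_dim c m)) (e1 e2 e3 kappa tau : R)
    (hgam : frenet_helix t o I gam e1 e2 e3 kappa tau) :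
  [/\ proper_harmonic t 2 I gam <->
        e2 * (e1 * kappa ^+ 2 + e3 * tau ^+ 2) = c * e1,
      proper_harmonic t 3 I gam <->
        e2 * (e1 * kappa ^+ 2 + e3 * tau ^+ 2) ^+ 2
        = c * (e1 * e3 * tau ^+ 2 + 2 * kappa ^+ 2) &
      forall r : nat, (4 <= r)%N ->
        proper_harmonic t r I gam <->
        (e1 * kappa ^+ 2 + e3 * tau ^+ 2) ^+ (r - 3)
        * (e2 * (e1 * kappa ^+ 2 + e3 * tau ^+ 2) ^+ 2
           - c * (e1 * e3 * tau ^+ 2 + (r%:R - 1) * kappa ^+ 2)) = 0].
Proof.
have [N [N_neq0 DT tensionE]] := frenet_helix_tension I_open hgam.
have [_ [_ [_ [_ [he1 he2 _] _ _ [kappa_gt0 _]]]]] := hgam.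
have e11 := sign_sqr he1.
have [s0 Is0] := I_neq0.
have e2_neq0 : e2 != 0 by case: he2 => ->; rewrite ?oppr_eq0 oner_eq0.
have b_neq0 : e2 * kappa != 0 by rewrite mulf_neq0// gt_eqF// (kappa_gt0 s0).
(* Since [kappa > 0], properness is automatic and only harmonicity remains to be characterized. *)
have not_geodesic : ~ geodesic t I gam.
  move=> /(_ s0 Is0)/eqP; rewrite DT// scaler_eq0 (negbTE b_neq0).
  by rewrite (negbTE (N_neq0 s0 Is0)).
set A := e1 * kappa ^+ 2 + e3 * tau ^+ 2 in tensionE *.
have proper q : proper_harmonic t q.+2 I gam <->
    (- (e2 * A)) ^+ q.+1 + c * e1 * (- (e2 * A)) ^+ q
      - q%:R * (c * e2 * kappa ^+ 2 * (- (e2 * A)) ^+ q.-1) = 0.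
  (* The scalar factor does not depend on [s], so the single point [s0] decides it. *)
  split=> [[/(_ s0 Is0)/eqP + _]|E].
    rewrite tensionE// scaler_eq0 (negbTE (N_neq0 s0 Is0)) orbF mulf_eq0.
    by rewrite (negbTE b_neq0) => /eqP.
  by split=> // s Is; rewrite tensionE// E mulr0 scale0r.
(* From order 3 on, all three exponents are at least [q = r - 3], so a common power of [A] factors
   out. *)
have properS q : proper_harmonic t q.+3 I gam <->
    A ^+ q * (e2 * A ^+ 2
      - c * (e1 * e3 * tau ^+ 2 + (q.+3%:R - 1) * kappa ^+ 2)) = 0.
  rewrite proper /=.
  set P := (X in X = 0 <-> _); set Q := (X in _ <-> X = 0).
  have -> : P = (- e2) ^+ q * e2 * Q.
    (* This turns the bracket into [e2 * A ^+ 2 - c * (e1 * A + (r - 2) * kappa ^+ 2)], the shape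
       given by the tension field. *)
    have e13E : e1 * e3 * tau ^+ 2 = e1 * A - kappa ^+ 2 by rewrite /A; ring: e11.
    have qE : q.+3%:R = q.+1%:R + 2 :> R by rewrite -natrD addn2.
    have powE : (- (e2 * A)) ^+ q = (- e2) ^+ q * A ^+ q by rewrite -mulNr exprMn.
    by rewrite /P /Q e13E qE !exprS powE; ring.
  split=> [/eqP|->]; last by rewrite mulr0.
  have e2q_neq0 : (- e2) ^+ q * e2 != 0.
    by rewrite mulf_neq0// expf_neq0// oppr_eq0.
  by rewrite mulf_eq0 (negbTE e2q_neq0) => /eqP.
split=> [||r r_ge4].
(* For [r = 2] the sum over [l >= 1] is empty, leaving [c * e1 - e2 * A = 0]. *)
- rewrite proper /= expr1 expr0 mulr1 mul0r subr0 addrC.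
  split=> [/eqP|->]; last by rewrite subrr.
  by rewrite subr_eq0 => /eqP ->.
- rewrite properS expr0 mul1r.
  have -> : 3%:R - 1 = 2 :> R by ring.
  split=> [/eqP|->]; last by rewrite subrr.
  by rewrite subr_eq0 => /eqP ->.
- have -> : r = (r - 3).+3 by lia.
  by rewrite properS !subSS subn0.
Qed.
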